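(* A subset $X$ of $\mathbb{R}$ is topologically universal if and only if it is a strong measure zero set.
   Context: A subset $X\subset\mathbb{R}$ is topologically universal if for every dense $G_\delta$ subset $G$ of $\mathbb{R}$ there exist $\lambda\in\mathbb{R}\setminus\{0\}$ and $t\in\mathbb{R}$ such that $\lambda X+t\subset G$, where $\lambda X+t=\{\lambda x+t:x\in X\}$. A subset $X\subset\mathbb{R}$ is a strong measure zero set if for every sequence $(\epsilon_n)_{n=1}^\infty$ of positive real numbers there exists a sequence of intervals $(I_n)_{n=1}^\infty$ such that $X\subset\bigcup_{n=1}^\infty I_n$ and $|I_n|<\epsilon_n$ for all $n$, where $|I_n|$ is the length of $I_n$. The ambient theory is $\mathsf{ZFC}$. *)

(* Defs.v *)
From HB Require Import structures.
From mathcomp Require Import all_boot all_order all_algebra.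
From mathcomp Require Import all_classical all_reals all_analysis borel_hierarchy.
Import Order.TTheory GRing.Theory Num.Theory.
Import numFieldNormedType.Exports.

Set Implicit Arguments.
Unset Strict Implicit.
Unset Printing Implicit Defensive.

Local Open Scope classical_set_scope.
Local Open Scope ring_scope.

Definition affine_copy (R : realType) (lambda t : R) (X : set R) : set R :=
  [set lambda * x + t | x in X].

Definition topologically_universal (R : realType) (X : set R) : Prop :=
  forall G : set R, Gdelta G -> dense G ->
    exists lambda t : R, lambda != 0 /\ affine_copy lambda t X `<=` G.

(* Sequences are indexed from 0, and [interval R] includes degenerate and empty
   intervals. The length of an interval is its Lebesgue measure, see
   [lebesgue_measure_itv]. *)
Definition strong_measure_zero (R : realType) (X : set R) : Prop :=
  forall eps : nat -> R, (forall n, 0 < eps n) ->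
    exists I : nat -> interval R,
      X `<=` \bigcup_n [set` I n] /\
      forall n, (lebesgue_measure [set` I n] < (eps n)%:E)%E.

(* Main.v *)
Require Import Defs.
From mathcomp Require Import all_boot all_order all_algebra.
From mathcomp Require Import all_classical all_reals all_analysis borel_hierarchy.
From mathcomp Require Import ring lra.
Import Order.TTheory GRing.Theory Num.Theory.
Import numFieldNormedType.Exports.

Set Implicit Arguments.
Unset Strict Implicit.
Unset Printing Implicit Defensive.

Local Open Scope classical_set_scope.
Local Open Scope ring_scope.

(** If [X] is universal, cover the rationals [q_n] by balls of radius
    [eps_n / (4 (k + 1))] and intersect over [k]. An affine copy of [X] with
    ratio [lambda] inside this dense Gdelta set gives a cover of [X] by
    intervals of length at most [eps_n / 2], as soon as [1 / |lambda| < k + 1].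

    Conversely (Galvin, Mycielski and Solovay), let [X] have strong measure
    zero and let [U k] be dense open. By compactness, the radius [e] of a ball
    contained in [U k] and in the ball of centre [y] and radius [d] can be
    chosen uniformly for bounded [y]. Hence the radii of a nested sequence of
    balls of translations can be fixed before covering [X] by small enough
    pieces, and each ball is then chosen so that its translations send one
    bounded piece into one [U k]. The ratio [lambda] is always [1]. *)

Lemma interval_dist_lt (R : realType) (i : interval R) (e x y : R) :
  (lebesgue_measure [set` i] < e%:E)%E -> x \in i -> y \in i -> `|x - y| < e.
Proof.
wlog xy : x y / x <= y.
  move=> wl ie xi yi; have [xy|/ltW yx] := leP x y; first exact: wl.
  by rewrite distrC; exact: wl.
move=> ie xi yi.
have sub : [set` `[x, y]] `<=` [set` i].
  by move=> z /=; rewrite in_itv /=; exact: interval_is_interval.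
have : (lebesgue_measure [set` `[x, y]] <= lebesgue_measure [set` i])%E.
  by apply: le_measure => //; rewrite inE; exact: measurable_itv.
move=> /le_lt_trans/(_ ie).
rewrite lebesgue_measure_itv/= lte_fin distrC ger0_norm ?subr_ge0//.
case: (ltP x y) => [_|yx].
  by rewrite -EFinD lte_fin.
by rewrite (lte_fin 0); apply: le_lt_trans; rewrite subr_le0.
Qed.

(** Of any two balls, the later one has its centre in both, so every left endpoint is at most every
    right endpoint. The supremum of the left endpoints is thus a common point. *)
Lemma nested_closed_balls (R : realType) (c r : nat -> R) :
  (forall n, 0 <= r n) ->
  (forall n w, `|w - c n.+1| <= r n.+1 -> `|w - c n| <= r n) ->
  exists t, forall n, `|t - c n| <= r n.
Proof.
move=> r0 nest.
have nestD m k w : `|w - c (m + k)%N| <= r (m + k)%N -> `|w - c m| <= r m.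
  by elim: k => [|k IH]; rewrite ?addn0// addnS => /nest.
have ab m n : c m - r m <= c n + r n.
  have H k : (k <= maxn m n)%N -> `|c (maxn m n) - c k| <= r k.
    move=> kmn; apply: (@nestD _ (maxn m n - k)%N).
    by rewrite subnKC// subrr normr0.
  have := H m (leq_maxl _ _); have := H n (leq_maxr _ _).
  by rewrite !ler_norml => /andP[_ h1] /andP[h2 _]; lra.
exists (sup (range (fun n => c n - r n))) => n.
have h1 : c n - r n <= sup (range (fun n => c n - r n)).
  apply: ub_le_sup; last by exists n.
  by exists (c 0%N + r 0%N) => _ [m _ <-].
have h2 : sup (range (fun n => c n - r n)) <= c n + r n.
  by apply: ge_sup; [exists (c 0%N - r 0%N), 0%N|move=> _ [m _ <-]].
by rewrite ler_norml; apply/andP; split; lra.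
Qed.

(** Compactness of [[-M, M]] is replaced by induction on the number of steps of length [d / 2] from
    [-M]. One ball near each grid point, within [d / 2] of it, serves all [y] in the next step, and
    [e] is the least of finitely many radii. *)
Lemma dense_open_uniform_ball (R : realType) (U : set R) (M d : R) :
  open U -> dense U -> 0 < d ->
  exists2 e, 0 < e & forall y, `|y| <= M ->
    exists z, forall w, `|w - z| <= e -> `|w - y| <= d /\ U w.
Proof.
move=> oU dU d0; have d20 : 0 < d / 2 by rewrite divr_gt0.
suff H (k : nat) : exists2 e, 0 < e & forall y, - M <= y <= - M + k%:R * (d / 2) ->
    exists z, forall w, `|w - z| <= e -> `|w - y| <= d /\ U w.
  have [e e0 He] := H (Num.bound (`|2 * M| / (d / 2))).
  exists e => // y; rewrite ler_norml => /andP[y1 y2]; apply: He.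
  rewrite y1/=.
  have /archi_boundP : 0 <= `|2 * M| / (d / 2) by rewrite divr_ge0// ltW.
  rewrite ltr_pdivrMr// => h; have := ler_norm (2 * M); lra.
have near y : exists z e, 0 < e /\ forall w, `|w - z| <= e -> `|w - y| <= d / 2 /\ U w.
  have oO : open (ball y (d / 2)) by exact: ball_open.
  have [|z [Oz Uz]] := dU (ball y (d / 2)) _ oO.
    by exists y; exact: ballxx.
  have : nbhs z (ball y (d / 2) `&` U).
    by apply: open_nbhs_nbhs; split => //; exact: openI.
  move=> /nbhs_ballP[e /= e0 He]; exists z, (e / 2); split.
    by rewrite divr_gt0.
  move=> w wz; have [|] := He w.
    by rewrite -ball_normE /= distrC (le_lt_trans wz)// ltr_pdivrMr// mulr2n mulrDr mulr1 ltrDl.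
  by rewrite -ball_normE /= distrC => /ltW.
elim: k => [|k [e e0 He]].
  have [z [e [e0 He]]] := near (- M).
  exists e => // y; rewrite mul0r addr0 -eq_le => /eqP <-; exists z => w /He[h ?].
  by split=> //; lra.
have [z [e' [e'0 He']]] := near (- M + k%:R * (d / 2)).
exists (Order.min e e'); first by rewrite lt_min e0.
move=> y /andP[y1 y2]; have [yk|yk] := leP y (- M + k%:R * (d / 2)).
  have [|z' Hz'] := He y; first by rewrite y1.
  by exists z' => w; rewrite le_min => /andP[/Hz'].
exists z => w; rewrite le_min => /andP[_ /He'[wy Uw]]; split=> //.
move: y2 wy; rewrite -natr1 !ler_norml => y2 /andP[h1 h2].
by apply/andP; split; lra.
Qed.

Lemma strong_measure_zero_translate (R : realType) (X : set R) (U : nat -> set R) :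
  strong_measure_zero X -> (forall k, open (U k)) -> (forall k, dense (U k)) ->
  exists t, forall x k, X x -> U k (x + t).
Proof.
move=> smzX oU dU.
(* A stage [(k, N, m)] handles the [m]-th piece of [X] within [[-N, N]]
   against [U k]. *)
pose stage n : nat * nat * nat := odflt (0, 0, 0)%N (unpickle n).
pose K n := (stage n).1.1; pose N n := (stage n).1.2; pose m n := (stage n).2.
(* The bound [N + 1] is meant for [y = c n + t n], where [c n] lies in [[-N, N]] and the translation
   [t n] in [[-1, 1]]. *)
have /choice[e He] (p : nat * R) : exists e, 0 < p.2 -> 0 < e /\
    forall y, `|y| <= (N p.1)%:R + 1 ->
    exists z, forall w, `|w - z| <= e -> `|w - y| <= p.2 /\ U (K p.1) w.
  have [p0|_] := ltP 0 p.2; last by exists 0.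
  by have [e e0 He] := dense_open_uniform_ball ((N p.1)%:R + 1) (oU (K p.1)) (dU _) p0; exists e.
(* Half of [e] is the radius of the next ball of translations; the other half allows for the
   distance from [x] to [c n] within a piece. *)
pose d := fix d n := if n is n'.+1 then e (n', d n') / 2 else 1.
have d0 n : 0 < d n.
  by elim: n => [//|n IH] /=; rewrite divr_gt0//; have [] := He (n, d n) IH.
(* Each pair [(k, N)] gets its own cover of [X], with lengths dictated by the stages that handle its
   intervals. *)
have /choice[I HI] (p : nat * nat) : exists I : nat -> interval R,
      X `<=` \bigcup_n [set` I n] /\
      forall n, (lebesgue_measure [set` I n] < (d (pickle (p, n)).+1)%:E)%E.
  by apply: smzX.
(* [c n] is a point of the piece if there is one, else 0. The length of the interval is controlled
   at the index [pickle (stage n)], which differs from [n] when [stage n] is the default value of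
   [odflt]. *)
have /choice[c Hc] n : exists c, `|c| <= (N n)%:R /\ forall x,
    x \in I (stage n).1 (m n) -> `|x| <= (N n)%:R ->
    pickle (stage n) = n -> `|x - c| <= d n.+1.
  have [[c [cI cN]]|nc] :=
    pselect (exists c, c \in I (stage n).1 (m n) /\ `|c| <= (N n)%:R).
    exists c; split=> // x xI xN sn; apply/ltW/interval_dist_lt; [|exact: xI|exact: cI].
    have := (HI (stage n).1).2 (m n).
    by rewrite -surjective_pairing sn.
  exists 0; rewrite normr0; split=> // x xI xN; case: nc.
  by exists x.
have /choice[z Hz] (p : nat * R) : exists z, `|p.2| <= (N p.1)%:R + 1 ->
    forall w, `|w - z| <= e (p.1, d p.1) -> `|w - p.2| <= d p.1 /\ U (K p.1) w.
  have [pN|_] := leP `|p.2| ((N p.1)%:R + 1); last by exists 0.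
  by have [_ /(_ _ pN)[z Hz]] := He (p.1, d p.1) (d0 _); exists z.
(* The ball around [z] consists of images of [c n']; subtracting [c n'] turns it into a ball of
   translations. *)
pose t := fix t n := if n is n'.+1 then z (n', c n' + t n') - c n' else 0.
have e2 n : e (n, d n) = d n.+1 + d n.+1 by rewrite /= -splitr.
have step n w : `|t n| <= 1 -> `|w - z (n, c n + t n)| <= d n.+1 + d n.+1 ->
    `|w - (c n + t n)| <= d n /\ U (K n) w.
  move=> tn; rewrite -e2; apply: (Hz (n, c n + t n)) => /=.
  by rewrite (le_trans (ler_normD _ _))// lerD//; have [] := Hc n.
have nest0 n w : `|t n| <= 1 -> `|w - t n.+1| <= d n.+1 -> `|w - t n| <= d n.
  move=> tn wt; have [|] := step n (w + c n) tn.
    move: wt; rewrite /= opprB addrA => /le_trans; apply.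
    by rewrite lerDl; exact: ltW (d0 n.+1).
  by have -> : w + c n - (c n + t n) = w - t n by ring.
(* All balls lie in the first one, [[-1, 1]]. Nesting at [n] itself requires the bound on [t n],
   hence the induction. *)
have ball1 n : forall w, `|w - t n| <= d n -> `|w| <= 1.
  elim: n => [|n IH] w; first by rewrite subr0.
  have tn : `|t n| <= 1 by apply: IH; rewrite subrr normr0 ltW.
  by move=> /(nest0 _ _ tn)/IH.
have t1 n : `|t n| <= 1 by apply: (ball1 n); rewrite subrr normr0 ltW.
have [|s Hs] := @nested_closed_balls R t d (fun n => ltW (d0 n)).
  by move=> n w; exact: nest0.
exists s => x k Xx.
pose B := Num.bound `|x|.
have [j _ /= xj] := (HI (k, B)).1 _ Xx.
pose n := pickle (k, B, j).
have sn : stage n = (k, B, j) by rewrite /stage pickleK.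
have xc : `|x - c n| <= d n.+1.
  have [_] := Hc n; apply; rewrite /m /N sn//=.
  exact/ltW/archi_boundP.
have [|_] := step n (x + s) (t1 n); last by rewrite /K sn.
have := Hs n.+1; rewrite /= -/(d n) => st.
have -> : x + s - z (n, c n + t n) = (x - c n) + (s - (z (n, c n + t n) - c n)).
  by ring.
by rewrite (le_trans (ler_normD _ _))// lerD.
Qed.

Lemma strong_measure_zero_universal (R : realType) (X : set R) :
  strong_measure_zero X -> topologically_universal X.
Proof.
move=> smzX G [U oU GU] dG.
have dU k : dense (U k).
  move=> O O0 oO; have [x [Ox]] := dG O O0 oO.
  by rewrite GU => /(_ k I) Ux; exists x.
have [t Ht] := strong_measure_zero_translate smzX oU dU.
exists 1, t; split; first exact: oner_neq0.
by move=> _ [x Xx <-]; rewrite mul1r GU => k _; exact: Ht.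
Qed.

Lemma universal_strong_measure_zero (R : realType) (X : set R) :
  topologically_universal X -> strong_measure_zero X.
Proof.
move=> uX eps eps0.
pose q n : R := ratr (odflt 0 (unpickle n)).
pose r n := eps n / 4.
have r0 n : 0 < r n by rewrite divr_gt0.
pose U k := \bigcup_n ball (q n) (r n / k.+1%:R).
have oU k : open (U k) by apply: bigcup_open => n _; exact: ball_open.
have dG : dense (\bigcap_k U k).
  move=> O O0 oO; have [x [Ox [p _ px]]] := dense_rat O0 oO.
  exists x; split=> // k _; exists (pickle p) => //.
  by rewrite /q pickleK /= px; apply: ballxx; rewrite divr_gt0.
have [|l [t [l0 XG]]] := uX (\bigcap_k U k) _ dG; first by exists U.
have nl0 : 0 < `|l| by rewrite normr_gt0.
(* The affine map pulls the [n]-th ball of [U k] back to radius [r n / (k.+1 * |l|)], which is at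
   most [r n] for the [k] chosen below. *)
exists (fun n => `](q n - t) / l - r n, (q n - t) / l + r n[); split=> [x Xx|n].
  pose k := Num.bound `|l|^-1.
  have [|n _ bn] := XG (l * x + t) _ k I; first by exists x.
  exists n => //; rewrite -ball_itv -ball_normE /=.
  have -> : (q n - t) / l - x = (q n - (l * x + t)) / l by field.
  rewrite normrM normfV ltr_pdivrMr//.
  move: bn; rewrite -ball_normE /= => /lt_le_trans; apply.
  rewrite ler_pM2l// invf_ple ?posrE//.
  apply: (@le_trans _ _ k%:R); last by rewrite ler_nat.
  by apply/ltW/archi_boundP; rewrite invr_ge0.
rewrite -ball_itv lebesgue_measure_ball ?ltW// lte_fin /r.
by have := eps0 n; lra.
Qed.

Theorem theorem2p4 (R : realType) (X : set R) :
  topologically_universal X <-> strong_measure_zero X.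
Proof.
split; [exact: universal_strong_measure_zero|exact: strong_measure_zero_universal].
Qed.
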